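(* Let $H$ be a finite-dimensional Hopf algebra over $\mathbb{C}$ whose underlying algebra is $\mathbb{Z}$-graded with a nontrivial $\mathbb{Z}$-grading $H=\bigoplus_{p\in\mathbb{Z}}A^p$. Suppose that the coproduct $\Delta$ of $H$ satisfies $$\Delta(A^p)\subseteq\bigoplus_{q\in\mathbb{Z}}A^q\otimes A^{p-q}\qquad\text{for all }p\in\mathbb{Z}.$$ Let $D(H)$ be the Drinfeld double of $H$, with $H$ and $H^*$ regarded as subalgebras of $D(H)$, and let $R=\sum_j a_j\otimes a_j^*\in D(H)\otimes D(H)$ be its canonical solution of the constant Yang--Baxter equation $R_{12}R_{13}R_{23}=R_{23}R_{13}R_{12}$, where $\{a_j\}$ is a basis of $H$ and $\{a_j^*\}$ is the dual basis of $H^*$. Then, taking $A=H=\bigoplus_pA^p$, there is a subalgebra $B$ of $D(H)$ with a nontrivial $\mathbb{Z}$-grading $B=\bigoplus_{p\in\mathbb{Z}}B^p$ such that $R$ can be written in the form $$R=\sum_{i,\alpha}a_\alpha^i\otimes b_\alpha^i,\qquad a_\alpha^i\in A^i,\ b_\alpha^i\in B^i .$$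
   Context: A $\mathbb{Z}$-grading of an associative algebra $A$ is a family of linear subspaces $\{A^p\mid p\in\mathbb{Z}\}$ such that (i) $A=\bigoplus_pA^p$, and (ii) multiplication maps $A^p\otimes A^q$ into $A^{p+q}$ for all $p,q$. The grading is nontrivial if $A^p\neq\{0\}$ for some $p\neq 0$. Dual Hopf algebra: for a finite-dimensional Hopf algebra $H$ over $\mathbb{C}$ with multiplication $m$, unit element $e$, coproduct $\Delta$ and counit $\epsilon$, $H^*$ is the space of linear maps $H\to\mathbb{C}$, with pairing $\langle f,x\rangle=f(x)$, and with the Hopf algebra structure determined by $\langle fg,x\rangle=\langle f\otimes g,\Delta(x)\rangle$ (multiplication), unit element $\epsilon$, $\langle\Delta^*(f),x\otimes y\rangle=\langle f,m(x\otimes y)\rangle$ (coproduct), and counit $f\mapsto\langle f,e\rangle$. If $\{a_j\}$ is a basis of $H$, the dual basis $\{a_j^*\}$ is given by $\langle a_i^*,a_j\rangle=\delta_{ij}$. Drinfeld double: $D(H)$ is Drinfeld's quasitriangular Hopf algebra spanned by the products $gh^*$ with $g\in H$, $h^*\in H^*$. It contains $H$ (identified via $a\mapsto a\,\epsilon$) and $H^*$ (identified via $f\mapsto e f$) as unital subalgebras, with their own multiplications as given above; the map $H\otimes H^*\to D(H)$, $g\otimes f\mapsto gf$, is a linear isomorphism; and products of $H^*$ with $H$ are determined by the relation (Sweedler notation $\Delta(x)=\sum x_{(1)}\otimes x_{(2)}$, $\Delta^*(f)=\sum f_{(1)}\otimes f_{(2)}$) $$\sum\langle f_{(2)},x_{(1)}\rangle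 f_{(1)}x_{(2)}=\sum\langle f_{(1)},x_{(2)}\rangle x_{(1)}f_{(2)}\qquad\text{for all }x\in H,\ f\in H^*.$$ The element $R=\sum_ja_j\otimes a_j^*$ is independent of the choice of basis and is a solution of the constant Yang--Baxter equation in $D(H)^{\otimes 3}$; here for $X=\sum_s x_s\otimes y_s$ one writes $X_{12}=\sum_s x_s\otimes y_s\otimes1$, $X_{13}=\sum_s x_s\otimes1\otimes y_s$, $X_{23}=\sum_s1\otimes x_s\otimes y_s$. *)

(* Defs.v *)
From HB Require Import structures.
From mathcomp Require Import all_boot all_order all_algebra all_field.

Set Implicit Arguments.
Unset Strict Implicit.
Unset Printing Implicit Defensive.

Import GRing.Theory.
Local Open Scope ring_scope.

(* Tensor products of finite-dimensional vector spaces, in coordinates: U ⊗ V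
   is the space of matrices indexed by the reference bases of U and V.  The
   lemmas tens_liftE and tens_lift_unique give its universal property. *)

Section Tensor.
Variable F : fieldType.

Definition tens (U V : vectType F) : Type := 'M[F]_(\dim {:U}, \dim {:V}).

HB.instance Definition _ (U V : vectType F) :=
  Vector.on (tens U V).

Definition refb (U : vectType F) (i : 'I_(\dim {:U})) : U :=
  (vbasis {:U})`_i.

Definition refc (U : vectType F) (i : 'I_(\dim {:U})) (u : U) : F :=
  coord (vbasis {:U}) i u.

Definition tensv (U V : vectType F) (u : U) (v : V) : tens U V :=
  \matrix_(i, j) (refc i u * refc j v).

(* Linear extension of a bilinear map b: the value is \sum_s b u_s v_s for
   t = \sum_s u_s ⊗ v_s.  Applied to t = Δ(x) it renders Sweedler notation:
   \sum b x_(1) x_(2) is tens_lift b (Δ x). *)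
Definition tens_lift (U V : vectType F) (W : lmodType F) (b : U -> V -> W)
    (t : tens U V) : W :=
  \sum_i \sum_j (t : 'M_(_, _)) i j *: b (refb i) (refb j).

(* The subspace S ⊗ T of U ⊗ V. *)
Definition tens_sub (U V : vectType F) (S : {vspace U}) (T : {vspace V}) :
    {vspace tens U V} :=
  <<[seq tensv u v | u <- vbasis S, v <- vbasis T]>>%VS.

Definition tens_mul (A B : falgType F) (s t : tens A B) : tens A B :=
  tens_lift (fun a b => tens_lift (fun c d => tensv (a * c) (b * d)) t) s.

End Tensor.

Notation "u ⊗ v" := (tensv u v) (at level 40, left associativity) : ring_scope.

Section TensorFacts.
Variables (F : fieldType) (U V : vectType F) (W : lmodType F).

Lemma refc_refb (X : vectType F) (i j : 'I_(\dim {:X})) :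
  refc j (refb i) = (i == j)%:R.
Proof. by rewrite /refc /refb coord_free ?(basis_free (vbasisP _)) // eq_sym. Qed.

Lemma refb_sum (X : vectType F) (u : X) : u = \sum_i refc i u *: refb i.
Proof.
exact: (coord_vbasis (memvf u)).
Qed.

Lemma tens_lift_linear (b : U -> V -> W) : linear (tens_lift b).
Proof.
move=> k s t; rewrite /tens_lift scaler_sumr -big_split; apply: eq_bigr => i _.
rewrite /= scaler_sumr -big_split; apply: eq_bigr => j _ /=.
by rewrite !mxE scalerDl scalerA.
Qed.

Lemma tens_liftE (b : U -> V -> W) (u : U) (v : V) :
  (forall v, linear (b^~ v)) -> (forall u, linear (b u)) ->
  tens_lift b (u ⊗ v) = b u v.
Proof.
move=> bl br.
have bls v' (I : finType) (c : I -> F) (x : I -> U) :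
    b (\sum_i c i *: x i) v' = \sum_i c i *: b (x i) v'.
  pose f : {linear U -> W} := HB.pack (b^~ v') (GRing.isLinear.Build _ _ _ _ _ (bl v')).
  by rewrite -[LHS]/(f _) linear_sum; apply: eq_bigr => i _; rewrite linearZ.
have brs u' (I : finType) (c : I -> F) (x : I -> V) :
    b u' (\sum_i c i *: x i) = \sum_i c i *: b u' (x i).
  pose f : {linear V -> W} := HB.pack (b u') (GRing.isLinear.Build _ _ _ _ _ (br u')).
  by rewrite -[LHS]/(f _) linear_sum; apply: eq_bigr => i _; rewrite linearZ.
rewrite [in RHS](refb_sum u) bls; apply: eq_bigr => i _.
rewrite [in RHS](refb_sum v) brs scaler_sumr; apply: eq_bigr => j _.
by rewrite mxE scalerA.
Qed.

Lemma tens_sum (t : tens U V) :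
  t = \sum_i \sum_j (t : 'M_(_, _)) i j *: (refb i ⊗ refb j).
Proof.
rewrite {1}(matrix_sum_delta t); apply: eq_bigr => i _; apply: eq_bigr => j _.
congr (_ *: _); apply/matrixP=> k l; rewrite !mxE !refc_refb -natrM mulnb.
by rewrite (eq_sym k) (eq_sym l).
Qed.

Lemma tens_lift_unique (f g : {linear tens U V -> W}) :
  (forall u v, f (u ⊗ v) = g (u ⊗ v)) -> f =1 g.
Proof.
move=> fg t; rewrite (tens_sum t) !linear_sum; apply: eq_bigr => i _.
by rewrite !linear_sum; apply: eq_bigr => j _; rewrite !linearZ fg.
Qed.

End TensorFacts.

Record hopf_algebra (F : fieldType) (H : falgType F) := HopfAlgebra {
  comul : {linear H -> tens H H};
  counit : {lrmorphism H -> F^o};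
  antipode : {linear H -> H};
  comulA : forall x,
    tens_lift (fun x1 x2 => tens_lift (fun y1 y2 => y1 ⊗ (y2 ⊗ x2)) (comul x1))
      (comul x) =
    tens_lift (fun x1 x2 => tens_lift (fun y1 y2 => x1 ⊗ (y1 ⊗ y2)) (comul x2))
      (comul x);
  counitl : forall x, tens_lift (fun x1 x2 => (counit x1 : F) *: x2) (comul x) = x;
  counitr : forall x, tens_lift (fun x1 x2 => (counit x2 : F) *: x1) (comul x) = x;
  comul1 : comul 1 = 1 ⊗ 1;
  comulM : forall x y, comul (x * y) = tens_mul (comul x) (comul y);
  antipodel : forall x,
    tens_lift (fun x1 x2 => antipode x1 * x2) (comul x) = (counit x : F)%:A;
  antipoder : forall x,
    tens_lift (fun x1 x2 => x1 * antipode x2) (comul x) = (counit x : F)%:A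
}.

Definition dual (F : fieldType) (H : vectType F) : Type := 'Hom(H, F^o).

HB.instance Definition _ (F : fieldType) (H : vectType F) :=
  Vector.on (dual H).

Definition pairing (F : fieldType) (H : vectType F) (f : dual H) (x : H) : F :=
  (f : 'Hom(H, F^o)) x.

Section Dual.
Variables (F : fieldType) (H : falgType F) (h : hopf_algebra H).

Definition dual_mul (f g : dual H) : dual H :=
  linfun (fun x => tens_lift (fun x1 x2 => (pairing f x1 * pairing g x2 : F^o))
                     (comul h x)).

Definition dual_one : dual H := linfun (counit h).

Definition dual_refb (i : 'I_(\dim {:H})) : dual H :=
  linfun (fun x : H => (refc i x : F^o)).

(* The unique element of H^* ⊗ H^* satisfying dual_comulE. *)
Definition dual_comul (f : dual H) : tens (dual H) (dual H) :=
  \sum_i \sum_j pairing f (refb i * refb j) *: (dual_refb i ⊗ dual_refb j).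

Lemma dual_mulE (f g : dual H) (x : H) :
  pairing (dual_mul f g) x =
  tens_lift (fun x1 x2 => (pairing f x1 * pairing g x2 : F^o)) (comul h x).
Proof.
pose b x1 x2 := (pairing f x1 * pairing g x2 : F^o).
have l : linear (fun x => tens_lift b (comul h x)).
  by move=> k y z; rewrite linearP tens_lift_linear.
pose l' : {linear H -> F^o} := HB.pack (fun x => tens_lift b (comul h x))
  (GRing.isLinear.Build _ _ _ _ _ l).
exact: (lfunE l').
Qed.

Lemma dual_oneE (x : H) : pairing dual_one x = counit h x.
Proof. exact: (lfunE (counit h)). Qed.

Lemma dual_refbE i (x : H) : pairing (dual_refb i) x = refc i x.
Proof.
have l : linear (fun x : H => (refc i x : F^o)).
  by move=> k y z; rewrite /refc linearP.
pose l' : {linear H -> F^o} := HB.pack (fun x : H => (refc i x : F^o))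
  (GRing.isLinear.Build _ _ _ _ _ l).
exact: (lfunE l').
Qed.

Lemma dual_comulE (f : dual H) (x y : H) :
  tens_lift (fun f1 f2 => (pairing f1 x * pairing f2 y : F^o)) (dual_comul f) =
  pairing f (x * y).
Proof.
pose b (f1 f2 : dual H) := (pairing f1 x * pairing f2 y : F^o).
pose l : {linear tens (dual H) (dual H) -> F^o} := HB.pack (tens_lift b)
  (GRing.isLinear.Build _ _ _ _ _ (tens_lift_linear b)).
rewrite -[LHS]/(l _) linear_sum [in RHS](refb_sum x) mulr_suml /pairing linear_sum.
apply: eq_bigr => i _; rewrite linear_sum [in RHS](refb_sum y) mulr_sumr linear_sum.
apply: eq_bigr => j _; rewrite linearZ /= tens_liftE; last 2 first.
- by move=> g k g1 g2; rewrite /b /pairing add_lfunE scale_lfunE mulrDl scalerAl.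
- by move=> g k g1 g2; rewrite /b /pairing add_lfunE scale_lfunE mulrDr scalerAr.
rewrite /b !dual_refbE -scalerAl -scalerAr !linearZ /= /pairing.
set c := f _; rewrite -[LHS]/(refc i x * (c * refc j y)).
by rewrite [c * _]mulrC.
Qed.

End Dual.

(* D(H) as an algebra: these data and axioms determine D up to a unique
   isomorphism compatible with the two embeddings. *)
Record drinfeld_double (F : fieldType) (H : falgType F) (h : hopf_algebra H)
    (D : falgType F) := DrinfeldDouble {
  dd_alg : {lrmorphism H -> D};
  dd_dual : {linear dual H -> D};
  dd_dual1 : dd_dual (dual_one h) = 1;
  dd_dualM : forall f g, dd_dual (dual_mul h f g) = dd_dual f * dd_dual g;
  dd_bij : bijective (tens_lift (fun (x : H) (f : dual H) => dd_alg x * dd_dual f));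
  dd_cross : forall (x : H) (f : dual H),
    tens_lift (fun f1 f2 => tens_lift (fun x1 x2 =>
        pairing f2 x1 *: (dd_dual f1 * dd_alg x2)) (comul h x)) (dual_comul f) =
    tens_lift (fun f1 f2 => tens_lift (fun x1 x2 =>
        pairing f1 x2 *: (dd_alg x1 * dd_dual f2)) (comul h x)) (dual_comul f)
}.

Definition is_direct_sum (F : fieldType) (V : vectType F) (I : eqType)
    (U : {vspace V}) (G : I -> {vspace V}) : Prop :=
  [/\ forall i, (G i <= U)%VS,
      forall x, x \in U -> exists s : seq I, x \in (\sum_(i <- s) G i)%VS
    & forall (s : seq I) (y : I -> V), uniq s -> (forall i, y i \in G i) ->
        \sum_(i <- s) y i = 0 -> forall i, i \in s -> y i = 0].

Definition Z_grading (F : fieldType) (A : falgType F) (U : {aspace A})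
    (G : int -> {vspace A}) : Prop :=
  is_direct_sum U G /\ forall p q, (G p * G q <= G (p + q)%R)%VS.

Definition nontrivial_grading (F : fieldType) (A : falgType F)
    (G : int -> {vspace A}) : Prop :=
  exists p : int, p != 0 /\ G p != 0%VS.

(* Main.v *)
Require Import Defs.
From HB Require Import structures.
From mathcomp Require Import all_boot all_order all_algebra all_field.
From mathcomp Require Import complex reals.

Import GRing.Theory.
Local Open Scope ring_scope.
Local Open Scope complex_scope.

(* The grading of H is encoded by its homogeneous projections P p.  Transposing
   them grades the dual: (H^* )^p consists of the functionals f = f \o P p, i.e.
   those vanishing on A^q for q != p.  Compatibility of the coproduct with the
   grading says exactly that the convolution product of H^* respects this
   grading, so B is the copy of H^* in D(H), graded by B^p = (H^* )^p.  Finally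
   R = \sum_p \sum_j P p a_j ⊗ (a_j^* \o P p), because moving P p from one tensor
   factor to the other does not change the canonical element and each P p is
   idempotent. *)

(** * Pure tensors and linear extensions of bilinear maps *)

Lemma tensv_linearl {F : fieldType} {U V : vectType F} (v : V) :
  linear (fun u : U => u ⊗ v).
Proof.
move=> k x y; apply/matrixP => i j.
by rewrite !mxE /refc linearP mulrDl mulrA.
Qed.

Lemma tensv_linearr {F : fieldType} {U V : vectType F} (u : U) :
  linear (fun v : V => u ⊗ v).
Proof.
move=> k x y; apply/matrixP => i j.
by rewrite !mxE /refc linearP mulrDr mulrCA.
Qed.

Lemma tensv_suml {F : fieldType} {U V : vectType F} {I : Type} (s : seq I)
    (c : I -> F) (x : I -> U) (v : V) :
  (\sum_(i <- s) c i *: x i) ⊗ v = \sum_(i <- s) c i *: (x i ⊗ v).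
Proof.
pose f : {linear U -> tens U V} :=
  HB.pack (fun u : U => u ⊗ v) (GRing.isLinear.Build _ _ _ _ _ (tensv_linearl v)).
by rewrite -[LHS]/(f _) linear_sum; apply: eq_bigr => i _; rewrite linearZ.
Qed.

Lemma tensv_sumr {F : fieldType} {U V : vectType F} {I : Type} (s : seq I)
    (c : I -> F) (u : U) (x : I -> V) :
  u ⊗ (\sum_(i <- s) c i *: x i) = \sum_(i <- s) c i *: (u ⊗ x i).
Proof.
pose f : {linear V -> tens U V} :=
  HB.pack (fun v : V => u ⊗ v) (GRing.isLinear.Build _ _ _ _ _ (tensv_linearr u)).
by rewrite -[LHS]/(f _) linear_sum; apply: eq_bigr => i _; rewrite linearZ.
Qed.

Lemma refc_neq0 {F : fieldType} {U : vectType F} (u : U) :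
  u != 0 -> exists i, refc i u != 0.
Proof.
move=> u0; apply/existsP; apply: contraNT u0; rewrite negb_exists => /forallP u0.
rewrite (refb_sum u) big1 // => i _.
by have /negPn/eqP -> := u0 i; rewrite scale0r.
Qed.

(** The entries of [u ⊗ v] are products of coordinates in a field, so a nonzero coordinate of each
    factor gives a nonzero entry. *)
Lemma tensv_eq0r {F : fieldType} {U V : vectType F} (u : U) (v : V) :
  u != 0 -> u ⊗ v = 0 -> v = 0.
Proof.
move=> /refc_neq0 [i ui] /matrixP uv0; apply/eqP; apply/negPn/negP.
move=> /refc_neq0 [j vj]; have /eqP := uv0 i j.
by rewrite !mxE mulf_eq0 (negPf ui) (negPf vj).
Qed.

(** [tens_sub S T] is spanned by pure tensors, on which the extension takes the value of [b].
    Phrasing the conclusion as inclusion in a kernel lets it pass to sums of subspaces. *)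
Lemma tens_lift_sub0 {F : fieldType} {U V W : vectType F} (b : U -> V -> W)
    (S : {vspace U}) (T : {vspace V}) :
  (forall v, linear (b^~ v)) -> (forall u, linear (b u)) ->
  (forall u v, u \in S -> v \in T -> b u v = 0) ->
  (tens_sub S T <= lker (linfun (tens_lift b)))%VS.
Proof.
move=> bl br b0; apply/span_subvP => t /allpairsP [[u v] /= [uS vT ->]].
pose l : {linear tens U V -> W} := HB.pack (tens_lift b)
  (GRing.isLinear.Build _ _ _ _ _ (tens_lift_linear b)).
rewrite memv_ker (lfunE l) /= tens_liftE //.
by apply/eqP/b0; apply: vbasis_mem.
Qed.

Lemma tens_lift_sum0 {F : fieldType} {U V W : vectType F} (b : U -> V -> W)
    {I : Type} (s : seq I) (S : I -> {vspace U}) (T : I -> {vspace V})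
    {t : tens U V} :
  (forall v, linear (b^~ v)) -> (forall u, linear (b u)) ->
  (forall i u v, u \in S i -> v \in T i -> b u v = 0) ->
  t \in (\sum_(i <- s) tens_sub (S i) (T i))%VS -> tens_lift b t = 0.
Proof.
move=> bl br b0 tin.
have /subvP/(_ t tin) :
    (\sum_(i <- s) tens_sub (S i) (T i) <= lker (linfun (tens_lift b)))%VS.
  elim/big_rec: _ => [|i X _ IH]; first exact: sub0v.
  by rewrite subv_add IH andbT tens_lift_sub0 // => u v; apply: b0.
pose l : {linear tens U V -> W} := HB.pack (tens_lift b)
  (GRing.isLinear.Build _ _ _ _ _ (tens_lift_linear b)).
by rewrite memv_ker (lfunE l) => /eqP.
Qed.

(** * Direct sums of subspaces and their projections *)

(** Each vector of a finite basis lies in a finite partial sum; concatenating the index lists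
    reaches the whole space. *)
Lemma direct_sum_finite {F : fieldType} {V : vectType F} {I : eqType}
    (G : I -> {vspace V}) :
  is_direct_sum fullv G ->
  exists2 s : seq I, uniq s & fullv = (\sum_(i <- s) G i)%VS.
Proof.
move=> [_ span_G _].
have sumG_mono (s t : seq I) : {subset s <= t} ->
    (\sum_(i <- s) G i <= \sum_(i <- t) G i)%VS.
  elim: s => [|i s IH] st; first by rewrite big_nil sub0v.
  rewrite big_cons subv_add IH ?andbT; last by move=> j js; rewrite st ?inE ?js ?orbT.
  by rewrite (big_rem i) ?addvSl // st ?inE ?eqxx.
have [s sP] : exists s : seq I, (<<vbasis {:V}>> <= \sum_(i <- s) G i)%VS.
  elim: (tval (vbasis {:V})) => [|x X [s IH]].
    by exists [::]; rewrite span_nil sub0v.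
  have [t xt] := span_G x (memvf x); exists (t ++ s).
  rewrite span_cons subv_add -memvE (subvP (sumG_mono _ _ _) _ xt) /=; last first.
    by move=> i it; rewrite mem_cat it.
  by apply: subv_trans IH (sumG_mono _ _ _) => i it; rewrite mem_cat it orbT.
exists (undup s); rewrite ?undup_uniq //; apply/eqP; rewrite eqEsubv subvf andbT.
rewrite (span_basis (vbasisP _)) in sP; apply: subv_trans sP (sumG_mono _ _ _) => i.
by rewrite mem_undup.
Qed.

(** The projections come from the finite decomposition indexed by [s]. Outside [s] the zero map
    serves, since independence forces [G i] to vanish there. *)
Lemma direct_sum_proj {F : fieldType} {V : vectType F} {I : eqType}
    (G : I -> {vspace V}) :
  is_direct_sum fullv G ->
  exists (s : seq I) (P : I -> 'End(V)),
    [/\ uniq s, forall i x, P i x \in G i,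
        forall i x, x \in G i -> P i x = x,
        forall i j x, i != j -> x \in G j -> P i x = 0
      & forall x, \sum_(i <- s) P i x = x].
Proof.
move=> dG; have [s us Vs] := direct_sum_finite G dG; case: dG => [_ _ indG].
pose P i : 'End(V) := if i \in s then sumv_pi_for Vs i else 0.
have PG i x : P i x \in G i.
  by rewrite /P; case: ifP => _; rewrite ?lfunE ?mem0v // memv_sum_pi.
have Psum x : \sum_(i <- s) P i x = x.
  rewrite -[RHS](sumv_pi_uniq_sum Vs) ?memvf ?filter_predT //.
  by apply: eq_big_seq => i si; rewrite /P si.
have Pdelta i j x : x \in G j -> P i x = if i == j then x else 0.
  (* [y] is the difference of two decompositions of [x]: into its components, and as a single term
     in degree [j]. Independence makes it vanish; [j] is added to the index list because it may lie
     outside [s]. *)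
  move=> xG; pose y k := P k x - (if k == j then x else 0).
  have yG k : y k \in G k.
    by rewrite memvB //; case: eqP => [->|_]; rewrite ?mem0v.
  pose t := undup (j :: s).
  have ut : uniq t by rewrite undup_uniq.
  have jt : j \in t by rewrite mem_undup inE eqxx.
  have y0 : \sum_(k <- t) y k = 0.
    rewrite sumrB [X in _ - X](bigD1_seq j) //= eqxx.
    rewrite [X in _ - (_ + X)]big1 => [|k /negPf -> //]; rewrite addr0.
    suff -> : \sum_(k <- t) P k x = x by rewrite subrr.
    rewrite /t /=; case: ifP => js; first by rewrite undup_id.
    by rewrite big_cons {1}/P js lfunE add0r undup_id.
  have [it|it] := boolP (i \in t).
    by apply/eqP; rewrite -subr_eq0; apply/eqP/(indG t y).
  have -> : P i x = 0.
    by rewrite /P ifN ?lfunE //; move: it; rewrite mem_undup inE => /norP[].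
  by rewrite ifN //; apply: contraNneq it => ->.
exists s, P; split=> // [i x xG|i j x ij xG]; first by rewrite (Pdelta i i) ?eqxx.
by rewrite (Pdelta i j) // (negPf ij).
Qed.

(** Independence follows by applying [P i] to a vanishing sum: only the [i]-th term survives. *)
Lemma direct_sum_of_proj {F : fieldType} {V : vectType F} {I : eqType}
    (s : seq I) (P : I -> 'End(V)) :
  (forall i x, P i (P i x) = P i x) ->
  (forall i j x, i != j -> P i (P j x) = 0) ->
  (forall x, \sum_(i <- s) P i x = x) ->
  is_direct_sum fullv (fun i => limg (P i)).
Proof.
move=> Pid Porth Psum; split=> [i|x _|t y ut yP y0 i it].
- exact: subvf.
- exists s; rewrite -(Psum x).
  elim: s {Psum} => [|i s IH]; first by rewrite !big_nil mem0v.
  by rewrite !big_cons memv_add // memv_img ?memvf.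
- have := congr1 (P i) y0; rewrite linear0 linear_sum (bigD1_seq i) //=.
  have /memv_imgP [z _ yz] := yP i; rewrite {1}yz Pid -yz big1 ?addr0 //.
  by move=> j ji; have /memv_imgP [w _ ->] := yP j; rewrite Porth // eq_sym.
Qed.

(** An injective map lets relations be pulled back to its source. This carries the grading of the
    dual over to its copy in the double. *)
Lemma direct_sum_img {F : fieldType} {V W : vectType F} {I : eqType}
    (f : 'Hom(V, W)) (G : I -> {vspace V}) :
  lker f == 0%VS -> is_direct_sum fullv G ->
  is_direct_sum (limg f) (fun i => (f @: G i)%VS).
Proof.
move=> /lker0P f_inj [_ span_G indG]; split=> [i|x|s y us yG y0 i si].
- by rewrite limgS ?subvf.
- move=> /memv_imgP [z _ ->]; have [s zs] := span_G z (memvf z).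
  by exists s; rewrite -limg_sum memv_img.
- pose z i := (f^-1)%VF (y i).
  have yz j : y j = f (z j).
    by rewrite limg_lfunVK //; apply: (subvP (limgS f (subvf (G j)))).
  have zG j : z j \in G j.
    by have /memv_imgP [w wG yw] := yG j; move: (yz j); rewrite yw => /f_inj <-.
  rewrite yz (indG s z) ?linear0 //; apply: f_inj.
  by rewrite linear0 linear_sum -[RHS]y0; apply: eq_bigr => j _; rewrite yz.
Qed.

(** * The transposed grading of the dual algebra *)

Definition transpose {F : fieldType} {V : vectType F} (P : 'End(V)) :
    'End(dual V) :=
  linfun (fun f : dual V => ((f : 'Hom(V, F^o)) \o P)%VF : dual V).

Lemma pairing_transpose {F : fieldType} {V : vectType F} (P : 'End(V))
    (f : dual V) (x : V) : pairing (transpose P f) x = pairing f (P x).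
Proof.
have l : linear (fun f : dual V => ((f : 'Hom(V, F^o)) \o P)%VF : dual V).
  by move=> k g1 g2; rewrite comp_lfunDl comp_lfunZl.
pose l' : {linear dual V -> dual V} := HB.pack
  (fun f : dual V => ((f : 'Hom(V, F^o)) \o P)%VF : dual V)
  (GRing.isLinear.Build _ _ _ _ _ l).
by rewrite /transpose (lfunE l') /= /pairing comp_lfunE.
Qed.

Lemma dualP {F : fieldType} {V : vectType F} (f g : dual V) :
  (forall x, pairing f x = pairing g x) -> f = g.
Proof. by move=> fg; apply/lfunP => x; apply: fg. Qed.

Lemma pairing_sumr {F : fieldType} {V : vectType F} (f : dual V) {I : Type}
    (s : seq I) (x : I -> V) :
  pairing f (\sum_(i <- s) x i) = \sum_(i <- s) pairing f (x i).
Proof. by rewrite /pairing linear_sum. Qed.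

Lemma pairing_suml {F : fieldType} {V : vectType F} {I : Type} (s : seq I)
    (f : I -> dual V) (x : V) :
  pairing (\sum_(i <- s) f i) x = \sum_(i <- s) pairing (f i) x.
Proof. by rewrite /pairing sum_lfunE. Qed.

(** Being fixed by the transpose of [P (p + q)] expresses homogeneity of degree [p + q]. For [x] of
    degree [r], the coproduct is a sum of terms in [A i ⊗ A (r - i)]; the two functionals kill such
    a term unless [i = p] and [r - i = q], which forces [r = p + q]. *)
Lemma dual_mul_graded {F : fieldType} {H : falgType F} (h : hopf_algebra H)
    (A : int -> {vspace H}) (s : seq int) (P : int -> 'End(H)) :
  (forall i x, P i x \in A i) ->
  (forall i x, x \in A i -> P i x = x) ->
  (forall i j x, i != j -> x \in A j -> P i x = 0) ->
  (forall x, \sum_(i <- s) P i x = x) ->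
  (forall (p : int) (x : H), x \in A p ->
     exists t : seq int,
       comul h x \in (\sum_(q <- t) tens_sub (A q) (A (p - q)%R))%VS) ->
  forall p q f g,
    dual_mul h (transpose (P p) f) (transpose (P q) g) =
    transpose (P (p + q)) (dual_mul h (transpose (P p) f) (transpose (P q) g)).
Proof.
move=> PA PAid PA0 Psum Dgr p q f g; set k := dual_mul _ _ _.
apply: dualP => x; rewrite pairing_transpose -(Psum x) linear_sum !pairing_sumr.
apply: eq_bigr => r _ /=; have := PA r x; move: (P r x) => {}x xA.
have [E|rpq] := eqVneq r (p + q); first by rewrite -E PAid.
rewrite (PA0 _ r) // 1?eq_sym // [RHS]linear0 dual_mulE.
have [t xt] := Dgr r x xA.
pose b y1 y2 : F^o :=
  pairing (transpose (P p) f) y1 * pairing (transpose (P q) g) y2.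
apply: (tens_lift_sum0 b t A (fun i => A (r - i)%R) _ _ _ xt).
- by move=> y c y1 y2; rewrite /b /pairing linearP mulrDl scalerAl.
- by move=> y c y1 y2; rewrite /b /pairing linearP mulrDr scalerAr.
move=> i u v uA vA; rewrite /b !pairing_transpose.
have [ip|ip] := eqVneq p i; last by rewrite (PA0 _ i u) // /pairing linear0 mul0r.
rewrite (PA0 q (r - i) v) // /pairing ?linear0 ?mulr0 //.
by apply: contra_neq rpq => ->; rewrite ip addrC subrK.
Qed.

(** * The copy of the dual inside the Drinfeld double *)

(** The image of [f] is that of [1 ⊗ f] under the bijection from [H ⊗ H^*] to the double, so its
    vanishing gives [1 ⊗ f = 0] and then [f = 0]. *)
Lemma dd_dual_ker {F : fieldType} {H : falgType F} {h : hopf_algebra H}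
    {D : falgType F} (DH : drinfeld_double h D) :
  lker (linfun (dd_dual DH)) == 0%VS.
Proof.
rewrite -subv0; apply/subvP => f; rewrite memv_ker lfunE /= => /eqP f0.
rewrite memv0; apply/eqP/(tensv_eq0r (1 : H)); first exact: oner_neq0.
apply: (bij_inj (dd_bij DH)); rewrite tens_liftE.
- rewrite f0 mulr0 /tens_lift big1 // => i _.
  by rewrite big1 // => j _; rewrite mxE scale0r.
- by move=> v k x y; rewrite linearP mulrDl scalerAl.
- by move=> u k x y; rewrite linearP mulrDr scalerAr.
Qed.

Lemma dd_dual_aspace {F : fieldType} {H : falgType F} {h : hopf_algebra H}
    {D : falgType F} (DH : drinfeld_double h D) :
  is_aspace (limg (linfun (dd_dual DH))).
Proof.
apply/andP; split.
  apply: has_algid1; rewrite -(dd_dual1 DH) -(lfunE (dd_dual DH)).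
  exact: memv_img (memvf _).
apply/prodvP => _ _ /memv_imgP [f _ ->] /memv_imgP [g _ ->].
by rewrite !lfunE /= -dd_dualM -(lfunE (dd_dual DH)) memv_img ?memvf.
Qed.

(** * The canonical element in dual bases *)

(** Duality forces [a' i] to be the [i]-th coordinate function of the basis [a]. *)
Lemma basis_expand {F : fieldType} {V : vectType F} {n : nat} (a : n.-tuple V)
    (a' : 'I_n -> dual V) :
  basis_of {:V} a ->
  (forall i j : 'I_n, pairing (a' i) (tnth a j) = (i == j)%:R) ->
  forall x, x = \sum_i pairing (a' i) x *: tnth a i.
Proof.
move=> Ha Ha' x; rewrite {1}(coord_basis Ha (memvf x)).
apply: eq_bigr => i _; rewrite (tnth_nth 0); congr (_ *: _).
rewrite {2}(coord_basis Ha (memvf x)) pairing_sumr (bigD1 i) //=.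
rewrite big1 ?addr0 => [|j ji]; rewrite /pairing linearZ -tnth_nth /=.
  by rewrite -/(pairing _ _) Ha' eqxx [RHS]mulr1.
by rewrite -/(pairing _ _) Ha' eq_sym (negPf ji) [LHS]mulr0.
Qed.

(** Both sides expand to the same double sum of [f a_i ⊗ g a'_j], weighted by the matrix entries of
    [P] in the basis [a]. *)
Lemma canonical_transpose {F : fieldType} {V U W : vectType F} {n : nat}
    (a : n.-tuple V) (a' : 'I_n -> dual V)
    (f : {linear V -> U}) (g : {linear dual V -> W}) (P : 'End(V)) :
  basis_of {:V} a ->
  (forall i j : 'I_n, pairing (a' i) (tnth a j) = (i == j)%:R) ->
  \sum_i f (tnth a i) ⊗ g (transpose P (a' i)) =
  \sum_i f (P (tnth a i)) ⊗ g (a' i).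
Proof.
move=> Ha Ha'; have aE := basis_expand a a' Ha Ha'.
have trE i : transpose P (a' i) = \sum_j pairing (a' i) (P (tnth a j)) *: a' j.
  apply: dualP => x; rewrite pairing_transpose pairing_suml {1}(aE x) linear_sum.
  rewrite pairing_sumr; apply: eq_bigr => j _.
  by rewrite linearZ /pairing linearZ scale_lfunE [LHS]mulrC.
transitivity (\sum_i \sum_j
    pairing (a' i) (P (tnth a j)) *: (f (tnth a i) ⊗ g (a' j))).
  apply: eq_bigr => i _; rewrite trE linear_sum -tensv_sumr.
  by congr (_ ⊗ _); apply: eq_bigr => j _; rewrite linearZ.
rewrite exchange_big; apply: eq_bigr => j _ /=; rewrite -tensv_suml.
rewrite [in RHS](aE (P (tnth a j))) linear_sum; congr (_ ⊗ _).
by apply: eq_bigr => i _; rewrite linearZ.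
Qed.

Theorem proposition2p2 (R : realType) (H : falgType R[i]) (h : hopf_algebra H)
    (A : int -> {vspace H})
    (HA : Z_grading {:H}%AS A) (HAnt : nontrivial_grading A)
    (HDelta : forall (p : int) (x : H), x \in A p ->
       exists s : seq int,
         comul h x \in (\sum_(q <- s) tens_sub (A q) (A (p - q)%R))%VS)
    (D : falgType R[i]) (DH : drinfeld_double h D)
    (n : nat) (a : n.-tuple H) (Ha : basis_of {:H} a)
    (a' : 'I_n -> dual H)
    (Ha' : forall i j : 'I_n, pairing (a' i) (tnth a j) = (i == j)%:R) :
  exists (B : {aspace D}) (Bp : int -> {vspace D}),
    [/\ 1 \in B, Z_grading B Bp, nontrivial_grading Bp &
      exists (s : seq int) (m : int -> nat)
             (u : int -> nat -> H) (v : int -> nat -> D),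
        [/\ uniq s,
            forall i k, u i k \in A i,
            forall i k, v i k \in Bp i
          & \sum_(j < n) dd_alg DH (tnth a j) ⊗ dd_dual DH (a' j) =
            \sum_(i <- s) \sum_(k < m i) dd_alg DH (u i k) ⊗ v i k]].
Proof.
have [s [P [us PA PAid PA0 Psum]]] := direct_sum_proj A (proj1 HA).
pose d := linfun (dd_dual DH).
have dE f : d f = dd_dual DH f by rewrite lfunE.
pose Bp p := (d @: limg (transpose (P p)))%VS.
have BpI p f : dd_dual DH (transpose (P p) f) \in Bp p.
  by rewrite -dE !memv_img ?memvf.
exists (ASpace (dd_dual_aspace DH)), Bp; split.
- by rewrite -(dd_dual1 DH) -dE; apply: memv_img (memvf _).
- split.
    apply: direct_sum_img (dd_dual_ker DH) _.
    apply: (direct_sum_of_proj s) => [i f|i j f ij|f].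
    + by apply: dualP => x; rewrite !pairing_transpose PAid.
    + apply: dualP => x; rewrite !pairing_transpose (PA0 j i) 1?eq_sym //.
      by rewrite /pairing linear0 lfunE.
    + apply: dualP => x; rewrite pairing_suml -[in RHS](Psum x) pairing_sumr.
      by apply: eq_bigr => i _; rewrite pairing_transpose.
  move=> p q; apply/prodvP => _ _ /memv_imgP [_ /memv_imgP [f _ ->] ->]
    /memv_imgP [_ /memv_imgP [g _ ->] ->]; rewrite !dE -dd_dualM.
  (* The product equals its own image under the transpose of [P (p + q)], hence lies in
     [Bp (p + q)]. *)
  by rewrite (dual_mul_graded h A s P PA PAid PA0 Psum HDelta).
- have [p [p0 Ap0]] := HAnt; exists p; split=> //.
  (* Take a nonzero [x] in [A p] and a coordinate [i] that is nonzero on it. Since [P p] fixes [x],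
     the transposed coordinate functional is still nonzero at [x]. *)
  have xA := memv_pick (A p); move: Ap0; rewrite -vpick0.
  move: (vpick _) xA => x xA /refc_neq0 [i xi].
  apply/negP => /eqP B0; have := BpI p (dual_refb i).
  rewrite B0 memv0 -dE => /eqP d0.
  have /(congr1 (fun f : dual H => pairing f x)) : transpose (P p) (dual_refb i) = 0.
    by apply: (lker0P (dd_dual_ker DH)); rewrite linear0.
  rewrite /= pairing_transpose PAid // dual_refbE /pairing lfunE => xi0.
  by rewrite xi0 eqxx in xi.
(* The families [u] and [v] are indexed by all naturals, so [a'] is extended by zero beyond [n]. *)
pose w k : dual H := if insub k is Some j then a' j else 0.
exists s, (fun=> n), (fun i k => P i a`_k),
  (fun i k => dd_dual DH (transpose (P i) (w k))).
split=> //.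
(* First split each basis vector in the left factor into its homogeneous components. *)
transitivity (\sum_(i <- s) \sum_(k < n)
    dd_alg DH (P i (tnth a k)) ⊗ dd_dual DH (a' k)).
  rewrite exchange_big; apply: eq_bigr => j _ /=.
  rewrite -[in LHS](Psum (tnth a j)) linear_sum.
  (* The coefficient 1 gives the sum the shape that [tensv_suml] expects. *)
  rewrite (eq_bigr (fun i => 1 *: dd_alg DH (P i (tnth a j)))) => [|i _].
    by rewrite tensv_suml; apply: eq_bigr => i _; rewrite scale1r.
  by rewrite scale1r.
apply: eq_bigr => i _.
(* With [P i] already built into [f], moving the transpose back from the right factor produces [P i]
   twice on the left, and idempotence removes one copy. *)
pose f : {linear H -> D} := dd_alg DH \o P i.
transitivity (\sum_k f (tnth a k) ⊗ dd_dual DH (transpose (P i) (a' k))).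
  rewrite canonical_transpose //; apply: eq_bigr => k _.
  by rewrite /f /= (PAid i (P i _)).
by apply: eq_bigr => k _; rewrite /f /= /w valK (tnth_nth 0).
Qed.
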